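(* Let $R$ be a finite principal left ideal ring, $<$ a respectful order on $R$, $B$ an ordered basis of $R^n$, and $P$ a left multiplicative property on $R^n$ with $P[0]$ false. Then the lexicode $C:=C(<,B,P)$ is maximal with respect to inclusion among all free left submodules $\tilde C\subseteq R^n$ such that $P[x]$ holds for all nonzero $x\in\tilde C$; i.e., there is no free left submodule $\tilde C$ with $C\subsetneq\tilde C$ all of whose nonzero elements satisfy $P$.
   Context: $R^\ast$ is the unit group of $R$. A property $P:R^n\to\{\text{true},\text{false}\}$ is left multiplicative if $P[ux]=P[x]$ for all $u\in R^\ast$, $x\in R^n$. A total order $<$ on $R$ is respectful if for all nonzero $x,y\in R$ with $Rx\supsetneq Ry$ there is $\alpha\in R^\ast$ with $\alpha x<uy$ for all $u\in R^\ast$. Fix an ordered basis $B=(b_1,\dots,b_n)$ of the free left module $R^n$; put $V_0=\{0\}$ and $V_i=Rb_1+\dots+Rb_i$. The lexicographic order on $R^n$: if $x\in V_{i-1}$ and $y\in V_i\setminus V_{i-1}$ then $x<y$; if $x\ne y$ both lie in $V_i\setminus V_{i-1}$, write $x=\sum_{j\le i}x_jb_j$, $y=\sum_{j\le i}y_jb_j$, let $k$ be the largest index with $x_k\ne y_k$, and set $x<y$ iff $x_k<y_k$ in $R$. Fix a set $\Gamma\subseteq R$ containing one generator of each nonzero left ideal of $R$. Greedy algorithm: $C_0=\{0\}$; for $i=1,\dots,n$, let $a_i$ be the smallest vector of $V_i\setminus V_{i-1}$ (if any) such that $P[\gamma a_i+c]$ is true for all $\gamma\in\Gamma$ and all $c\in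 C_{i-1}$; if such $a_i$ exists set $C_i=Ra_i+C_{i-1}$, otherwise $C_i=C_{i-1}$. The lexicode is $C(<,B,P):=C_n$. *)

(* Defs.v *)
From HB Require Import structures.
From mathcomp Require Import all_boot all_order all_algebra.
Set Implicit Arguments. Unset Strict Implicit. Unset Printing Implicit Defensive.
Import GRing.Theory.
Local Open Scope ring_scope.

Section Lexicodes.
Variable R : finUnitRingType.

Definition left_ideal (I : {set R}) : Prop :=
  [/\ (0 : R) \in I,
      forall x y, x \in I -> y \in I -> x + y \in I &
      forall r x, x \in I -> r * x \in I].

Definition lprincipal (x : R) : {set R} := [set r * x | r : R].

Definition principal_left_ideal_ring : Prop :=
  forall I : {set R}, left_ideal I -> exists g : R, I = lprincipal g.

Definition strict_total_order (lt : rel R) : Prop :=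
  [/\ forall x, ~~ lt x x,
      forall x y z, lt x y -> lt y z -> lt x z &
      forall x y, x != y -> lt x y || lt y x].

Definition respectful (lt : rel R) : Prop :=
  forall x y : R, x != 0 -> y != 0 ->
    lprincipal y \proper lprincipal x ->
    exists2 a : R, a \is a GRing.unit &
      forall u : R, u \is a GRing.unit -> lt (a * x) (u * y).

Variable n : nat.
Notation vec := 'rV[R]_n.

Definition left_multiplicative (P : vec -> bool) : Prop :=
  forall (u : R) (x : vec), u \is a GRing.unit -> P (u *: x) = P x.

Definition comb (k : nat) (b : 'I_k -> vec) (c : 'rV[R]_k) : vec :=
  \sum_(j < k) c 0 j *: b j.

Definition ordered_basis (B : 'I_n -> vec) : Prop := bijective (comb B).

Definition coord (B : 'I_n -> vec) (x : vec) : 'rV[R]_n :=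
  odflt 0 [pick c | comb B c == x].

(* V_i = R b_1 + ... + R b_i  (b_1 .. b_i are B 0 .. B (i-1)). *)
Definition inV (B : 'I_n -> vec) (i : nat) (x : vec) : bool :=
  [exists c : 'rV[R]_n,
     (comb B c == x) && [forall j : 'I_n, (i <= j)%N ==> (c 0 j == 0)]].

Definition level_set (B : 'I_n -> vec) (i : nat) (x : vec) : bool :=
  inV B i x && ~~ inV B i.-1 x.

Definition lexlt (lt : rel R) (B : 'I_n -> vec) (x y : vec) : bool :=
  [exists i : 'I_n,
    level_set B i.+1 y &&
    (inV B i x ||
     [&& level_set B i.+1 x, x != y &
        [exists k : 'I_n,
           [&& coord B x 0 k != coord B y 0 k,
               [forall j : 'I_n, (k < j)%N ==> (coord B x 0 j == coord B y 0 j)] &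
               lt (coord B x 0 k) (coord B y 0 k)]]])].

Definition admissible (P : vec -> bool) (Gamma : {set R}) (C : {set vec})
    (a : vec) : bool :=
  [forall g in Gamma, forall c in C, P (g *: a + c)].

Definition greedy_pick (lt : rel R) (B : 'I_n -> vec) (P : vec -> bool)
    (Gamma : {set R}) (C : {set vec}) (i : nat) : option vec :=
  [pick a | [&& level_set B i a, admissible P Gamma C a &
     [forall y, (level_set B i y && admissible P Gamma C y) ==>
                  ((y == a) || lexlt lt B a y)]]].

Fixpoint greedy (lt : rel R) (B : 'I_n -> vec) (P : vec -> bool)
    (Gamma : {set R}) (i : nat) : {set vec} :=
  match i with
  | 0 => [set 0]
  | i'.+1 =>
      let C := greedy lt B P Gamma i' in
      match greedy_pick lt B P Gamma C i'.+1 with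
      | Some a => [set r *: a + c | r in [set: R], c in C]
      | None => C
      end
  end.

Definition lexicode (lt : rel R) (B : 'I_n -> vec) (P : vec -> bool)
    (Gamma : {set R}) : {set vec} := greedy lt B P Gamma n.

Definition generator_system (Gamma : {set R}) : Prop :=
  (forall g, g \in Gamma -> g != 0) /\
  (forall I : {set R}, left_ideal I -> I != [set 0] ->
     exists! g, g \in Gamma /\ I = lprincipal g).

Definition left_submodule (S : {set vec}) : Prop :=
  [/\ (0 : vec) \in S,
      forall x y, x \in S -> y \in S -> x + y \in S &
      forall (r : R) x, x \in S -> r *: x \in S].

Definition free_left_submodule (S : {set vec}) : Prop :=
  left_submodule S /\
  exists (k : nat) (b : 'I_k -> vec),
    injective (comb b) /\ (forall y, y \in S <-> exists c, comb b c = y).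

End Lexicodes.

(* Main.v *)
(** Let [Ct] be a free module strictly containing the lexicode [C].  The code
    [C] is free, say of rank [m], and some [d] in [Ct] satisfies
    [r d \in C -> r = 0].  Indeed, in a finite principal left ideal ring
    [|ann_r L| |L| <= |R|] for every maximal left ideal [L]; climbing a chain of
    submodules gives [|N| |N^perp| <= |R|^k] for all [N <= R^k].  Hence a matrix
    with [m] independent rows has a right inverse, and since finite rings have
    stable range 1 its rows extend to a larger independent family.

    Among all such [d] take one in [V_i] with [i] minimal.  Then [d] is admissible
    at step [i], so a vector [a_i] was chosen there.  Let [x] and [y] be the
    leading coordinates of [a_i] and [d].  Minimality of [i] forces [y] outside
    [R x], and stable range 1 gives [t] with [R (x + t y) = R x + R y].  A unit
    multiple of [a_i + t d] is then admissible and, as the order is respectful,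
    smaller than [a_i]: contradiction. *)

Require Import Defs.
From HB Require Import structures.
From mathcomp Require Import all_boot all_order all_algebra.
Set Implicit Arguments. Unset Strict Implicit. Unset Printing Implicit Defensive.
Import GRing.Theory.
Local Open Scope ring_scope.

(** * Stable range of finite rings *)

Section StableRange.
Variable R : finUnitRingType.
Implicit Types x y : R.

(** Left multiplication by [b] is injective, hence surjective on a finite ring, and the right
    inverse it yields must be [a]. *)
Lemma fin_mul1_unit (a b : R) : a * b = 1 -> b \is a GRing.unit.
Proof.
move=> ab1; have injb : injective ( *%R b).
  by move=> x y /(congr1 ( *%R a)); rewrite !mulrA ab1 !mul1r.
have [c bc1] : exists c, b * c = 1 by exists (invF injb 1); apply: f_invF.
apply/unitrP; exists a; split=> //.
by rewrite -[a]mulr1 -[in a * 1]bc1 [a * _]mulrA ab1 mul1r.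
Qed.

Lemma fin_idempotent_power x : exists N, x ^+ N.+1 * x ^+ N.+1 = x ^+ N.+1.
Proof.
pose f (i : 'I_#|R|.+1) := x ^+ i.
have /injectivePn [i [j neq_ij fij]] : ~~ injectiveb f.
  by apply/negP=> /injectiveP/leq_card; rewrite card_ord ltnn.
wlog lt_ij : i j neq_ij fij / (i < j)%N.
  move=> W; case: (ltngtP i j) => [h|h|h]; first exact: (W i j).
    by apply: (W j i) => //; rewrite eq_sym.
  by case/eqP: neq_ij; apply: val_inj.
have [p p_gt0 Dj] : exists2 p, (0 < p)%N & j = (i + p)%N :> nat.
  by exists (j - i)%N; rewrite ?subn_gt0 // subnKC // ltnW.
have period k q : x ^+ (i + k + q * p) = x ^+ (i + k).
  elim: q => [|q IH]; first by rewrite addn0.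
  have -> : (i + k + q.+1 * p = j + (k + q * p))%N.
    by rewrite mulSn Dj -!addnA; congr (i + _)%N; rewrite addnCA.
  by rewrite exprD -/(f j) -fij -exprD addnA IH.
(* This exponent is a multiple of the period [p] and at least [i], so doubling it leaves the power
   unchanged; [i.+1] keeps it positive. *)
exists (i.+1 * p).-1; rewrite prednK ?muln_gt0 // -exprD.
have le_i : (i <= i.+1 * p)%N.
  by apply: leq_trans (leqnSn i) _; rewrite leq_pmulr.
by rewrite -[X in (X + _)%N](subnKC le_i) period subnKC.
Qed.

Lemma nilpotent_unit_sub1 x n : x ^+ n = 0 -> 1 - x \is a GRing.unit.
Proof.
move=> xn0; pose S := \sum_(i < n) x ^+ i.
have xS1 : (1 - x) * S = 1 by rewrite -opprB mulNr -subrX1 xn0 sub0r opprK.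
have Su := fin_mul1_unit xS1.
by rewrite -(mulrK Su (1 - x)) xS1 mul1r unitrV.
Qed.

(** The Jacobson radical [J] by quasi-regularity; a factor on each side makes it visibly stable
    under multiplication from both sides. *)
Definition jacobson x :=
  [forall r, forall s, (1 - r * x * s) \is a GRing.unit].

Lemma jacobsonP x :
  reflect (forall r s, (1 - r * x * s) \is a GRing.unit) (jacobson x).
Proof. exact: (iffP 'forall_forallP). Qed.

Lemma jacobsonMl a x : jacobson x -> jacobson (a * x).
Proof. by move=> /jacobsonP Jx; apply/jacobsonP=> r s; rewrite mulrA. Qed.

Lemma jacobsonMr a x : jacobson x -> jacobson (x * a).
Proof.
move=> /jacobsonP Jx; apply/jacobsonP=> r s.
by rewrite mulrA -[_ * a * s]mulrA.
Qed.

Lemma jacobsonD x y : jacobson x -> jacobson y -> jacobson (x + y).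
Proof.
move=> /jacobsonP Jx /jacobsonP Jy; apply/jacobsonP=> r s.
have u1 := Jx r s; set u := 1 - r * x * s in u1.
rewrite mulrDr mulrDl opprD addrA -/u.
have -> : u - r * y * s = u * (1 - (u^-1 * r) * y * s).
  by rewrite mulrBr mulr1 !mulrA divrr // mul1r.
by rewrite unitrMl ?Jy.
Qed.

Lemma jacobsonN x : jacobson x -> jacobson (- x).
Proof. by move/(jacobsonMl (-1)); rewrite mulN1r. Qed.

Lemma jacobsonB x y : jacobson x -> jacobson y -> jacobson (x - y).
Proof. by move=> Jx /jacobsonN; apply: jacobsonD. Qed.

Lemma jacobson0 : jacobson 0.
Proof. by apply/jacobsonP=> r s; rewrite mulr0 mul0r subr0 unitr1. Qed.

Lemma jacobson_idempotent x : x * x = x -> jacobson x -> x = 0.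
Proof.
move=> xx /jacobsonP/(_ 1 1); rewrite mul1r mulr1 => ux.
by apply: (mulrI ux); rewrite mulr0 mulrBl mul1r xx subrr.
Qed.

(** If [1 - r x s] is not a unit, take an idempotent power of [s r x]. Inside [J] it would vanish,
    making [r x s] nilpotent and [1 - r x s] a unit. *)
Lemma jacobsonPn_idempotent x : ~~ jacobson x ->
  exists c, (c * x) * (c * x) = c * x /\ ~~ jacobson (c * x).
Proof.
rewrite negb_forall => /existsP[r]; rewrite negb_forall => /existsP[s] nu.
have [N idem] := fin_idempotent_power (s * r * x).
exists ((s * r * x) ^+ N * (s * r)).
rewrite -[_ * (s * r) * x]mulrA -exprSr; split=> //.
apply/negP=> /(jacobson_idempotent idem) z0.
case/negP: nu; apply: (@nilpotent_unit_sub1 _ N.+2).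
have -> : (r * x * s) ^+ N.+2 = r * x * (s * r * x) ^+ N.+1 * s.
  elim: N.+1 => [|m IH]; first by rewrite expr1 expr0 mulr1.
  by rewrite exprSr IH [in RHS]exprSr !mulrA.
by rewrite z0 mulr0 mul0r.
Qed.

(* If [x = a + t b] is chosen with [R x + J] as large as possible and is not a
   unit, some idempotent [e] outside [J] has [e x] in [J].  Adding [e s b] to
   [x] would enlarge [R x + J] unless [e R] is contained in [R x + J], and then
   [e] is congruent to an element of [e R x^m] for every [m]; taking for [x^m]
   an idempotent power puts [e] in [J]. *)
Lemma left_stable_range1 (a b p q : R) :
  p * a + q * b = 1 -> exists t, a + t * b \is a GRing.unit.
Proof.
(* [gen x] is the left ideal [R x + J]. *)
move=> ab1; pose gen x := [set z | [exists r, jacobson (z - r * x)]].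
have genP x z : reflect (exists r, jacobson (z - r * x)) (z \in gen x).
  by rewrite inE; apply: existsP.
case: (arg_maxnP (P := xpredT) (fun t => #|gen (a + t * b)|) (i0 := 0) isT).
move=> t _ tmax; exists t; apply: contraT => nux; exfalso.
set x := a + t * b in nux tmax.
have xb1 : p * x + (q - p * t) * b = 1.
  by rewrite mulrDr mulrBl mulrA addrACA subrr addr0.
have {}tmax (s : R) : (#|gen (x + s * b)%R| <= #|gen x|)%N.
  by have := tmax (t + s) isT; rewrite mulrDl addrA.
move: (q - p * t) xb1 => q' xb1; clearbody x.
have [N e0idem] := fin_idempotent_power x; set e0 := x ^+ N.+1 in e0idem.
(* Otherwise right multiplication by [x] is injective modulo [J]; then [(1 - e0) e0 = 0] puts the
   idempotent [1 - e0] in [J], so [e0 = 1] and [x] is a unit. *)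
have [k Jkx nJk] : exists2 k, jacobson (k * x) & ~~ jacobson k.
  apply/exists_inP; apply: contraNT nux; rewrite negb_exists_in.
  move=> /forall_inP H.
  have H' k : jacobson (k * x) -> jacobson k by move/H; rewrite negbK.
  have {}H' m : jacobson ((1 - e0) * x ^+ m) -> jacobson (1 - e0).
    elim: m => [|m IH]; first by rewrite expr0 mulr1.
    by rewrite exprSr mulrA => /H'/IH.
  have e01 : e0 = 1.
    apply/esym/eqP; rewrite -subr_eq0; apply/eqP/jacobson_idempotent.
      by rewrite mulrBl mul1r mulrBr mulr1 e0idem subrr subr0.
    by apply: (H' N.+1); rewrite mulrBl mul1r e0idem subrr jacobson0.
  by apply: (@fin_mul1_unit (x ^+ N)); rewrite -exprSr.
have [c [eidem nJe]] := jacobsonPn_idempotent nJk.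
set e := c * k in eidem nJe.
have Jex : jacobson (e * x) by rewrite /e -mulrA jacobsonMl.
clearbody e.
have [s nesb] : exists s, e * s * b \notin gen x.
  apply/existsP; apply: contraNT nJe; rewrite negb_exists => /forallP H.
  have gene r : exists i, jacobson (e * r - e * i * x).
    have /genP [i Ji] : e * (r * q') * b \in gen x by have := H (r * q'); rewrite negbK.
    exists (r * p + i).
    have -> : e * r = e * r * p * x + e * (e * (r * q') * b).
      by rewrite !mulrA eidem -!mulrA -!mulrDr xb1 mulr1.
    have -> : e * (r * p + i) * x = e * r * p * x + e * (i * x).
      by rewrite mulrDr mulrDl !mulrA.
    by rewrite opprD addrACA subrr add0r -mulrBr jacobsonMl.
  have genm m r : exists i, jacobson (e * r - e * i * x ^+ m).
    elim: m r => [|m IH] r; first by exists r; rewrite mulr1 subrr jacobson0.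
    have [i Ji] := IH r; have [j Jj] := gene i; exists j.
    have -> : e * r - e * j * x ^+ m.+1
            = (e * r - e * i * x ^+ m) + (e * i - e * j * x) * x ^+ m.
      by rewrite mulrBl addrA subrK exprS !mulrA.
    by rewrite jacobsonD // jacobsonMr.
  have [i] := genm N.+1 1; rewrite mulr1 -/e0 => Ji.
  have Jee0 : jacobson (e * e0) by rewrite /e0 exprS mulrA jacobsonMr.
  have -> : e = (e - e * i * e0) - (e - e * i * e0) * e0 + e * e0.
    by rewrite [X in _ - X + _]mulrBl -[e * i * e0 * e0]mulrA e0idem
         opprB addrA subrK subrK.
  by rewrite jacobsonD // jacobsonB // jacobsonMr.
have := tmax (e * s); rewrite leqNgt.
set x' := x + e * s * b; case/negP; apply: proper_card.
(* As [e x] is in [J], [x] is congruent to [(1 - e) x'], so [R x + J] lies in [R x' + J]; and [e x']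
   contributes the new element [e s b]. *)
have ex' : (1 - e) * x' = (1 - e) * x.
  rewrite mulrDr [X in _ + X](_ : _ = 0) ?addr0 //.
  by rewrite mulrBl mul1r !mulrA eidem subrr.
apply/properP; split.
  apply/subsetP=> z /genP[r Jr]; apply/genP; exists (r * (1 - e)).
  rewrite -mulrA ex' mulrBl mul1r mulrBr opprB addrCA addrC -[r * (e * x)]opprK.
  by rewrite opprK jacobsonD // jacobsonMl.
exists (e * s * b) => //; apply/genP; exists e.
by rewrite mulrDr !mulrA eidem opprD addrC subrK jacobsonN.
Qed.

End StableRange.

(** With this, right stable range is left stable range read in the converse ring. *)
HB.instance Definition _ (R : finUnitRingType) := Finite.copy R^c R.

Lemma right_stable_range1 (R : finUnitRingType) (a b p q : R) :
  a * p + b * q = 1 -> exists t, a + b * t \is a GRing.unit.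
Proof. by move=> ab1; have [t ut] := @left_stable_range1 R^c a b p q ab1; exists t. Qed.

HB.instance Definition _ (U V : finZmodType) := Finite.on (U * V)%type.

(** Each fibre of [f] on the subgroup [A] is a translate of the kernel. *)
Lemma card_additive_fibers (V W : finZmodType) (f : V -> W) (A : {set V}) :
  {morph f : x y / x - y} -> {in A &, forall x y, x - y \in A} ->
  #|A| = (#|f @: A| * #|[set x in A | f x == 0%R]|)%N.
Proof.
move=> fB AB; rewrite -sum1_card (partition_big_imset f) /= -sum_nat_const.
apply: eq_bigr => _ /imsetP[x0 Ax0 ->]; rewrite sum1dep_card.
rewrite -[in RHS](card_imset _ (addIr x0)); apply: eq_card => x; rewrite inE.
apply/andP/imsetP => [[Ax /eqP fx]|[y]].
  by exists (x - x0); rewrite ?subrK // inE AB // fB fx subrr eqxx.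
rewrite inE => /andP[Ay /eqP fy] ->.
have A0 : 0 \in A by rewrite -(subrr x0) AB.
have f0 : f 0 = 0 by rewrite -(subrr 0) fB subrr.
have AN z : z \in A -> - z \in A by move=> Az; rewrite -sub0r AB.
have fN z : f (- z) = - f z by rewrite -sub0r fB f0 sub0r.
by rewrite -[x0 in y + x0]opprK AB ?AN // fB fy fN sub0r opprK.
Qed.

(** * Annihilators of left ideals *)

Section LeftIdeals.
Variable R : finUnitRingType.
Hypothesis pid : principal_left_ideal_ring R.

Lemma left_ideal_opp (I : {set R}) x : left_ideal I -> x \in I -> - x \in I.
Proof. by case=> _ _ IM Ix; rewrite -mulN1r IM. Qed.

Lemma left_ideal_sub (I : {set R}) x y :
  left_ideal I -> x \in I -> y \in I -> x - y \in I.
Proof. by move=> hI Ix Iy; have [_ ID _] := hI; rewrite ID // left_ideal_opp. Qed.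

Lemma left_ideal_sum (I : {set R}) q (F : 'I_q -> R) :
  left_ideal I -> (forall j, F j \in I) -> \sum_j F j \in I.
Proof. by case=> I0 ID _ IF; apply: (big_ind (fun x => x \in I)). Qed.

Lemma lprincipal_left_ideal (x : R) : left_ideal (lprincipal x).
Proof.
split=> [|y z /imsetP[r _ ->] /imsetP[s _ ->]|r y /imsetP[s _ ->]].
- by apply/imsetP; exists 0; rewrite ?mul0r.
- by apply/imsetP; exists (r + s); rewrite ?mulrDl.
by apply/imsetP; exists (r * s); rewrite ?mulrA.
Qed.

Definition rann (L : {set R}) : {set R} := [set v | [forall l in L, l * v == 0]].

Lemma rannP (L : {set R}) v :
  reflect (forall l, l \in L -> l * v = 0) (v \in rann L).
Proof.
rewrite inE; apply: (iffP forall_inP) => H l Ll; last by rewrite H.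
by apply/eqP/H.
Qed.

Definition lspan q (v e : {ffun 'I_q -> R}) := \sum_j e j * v j.

Lemma lspanB q (v e f : {ffun 'I_q -> R}) : lspan v (e - f) = lspan v e - lspan v f.
Proof. by rewrite -sumrB; apply: eq_bigr => j _; rewrite !ffunE mulrBl. Qed.

Lemma lspanZ q (v e : {ffun 'I_q -> R}) r :
  lspan v [ffun j => r * e j] = r * lspan v e.
Proof. by rewrite mulr_sumr; apply: eq_bigr => j _; rewrite ffunE mulrA. Qed.

Lemma lspan_delta q (v : {ffun 'I_q -> R}) i :
  lspan v [ffun j => (j == i)%:R] = v i.
Proof.
rewrite /lspan (bigD1 i) //= ffunE eqxx mul1r big1 ?addr0 // => j /negPf ji.
by rewrite ffunE ji mul0r.
Qed.

Lemma lspan_left_ideal q (v : {ffun 'I_q -> R}) :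
  left_ideal [set lspan v e | e : {ffun 'I_q -> R}].
Proof.
split=> [|y z /imsetP[e _ ->] /imsetP[f _ ->]|r y /imsetP[e _ ->]].
- by apply/imsetP; exists 0; rewrite ?/lspan ?big1 // => j _; rewrite ffunE mul0r.
- apply/imsetP; exists (e + f); rewrite // -big_split.
  by apply: eq_bigr => j _; rewrite ffunE mulrDl.
by apply/imsetP; exists [ffun j => r * e j]; rewrite ?lspanZ.
Qed.

(** * The right annihilator of a maximal left ideal *)

Section MaximalIdeal.
Variable L : {set R}.
Hypothesis idealL : left_ideal L.
Hypothesis properL : 1 \notin L.
Hypothesis maxL : forall r, r \notin L -> exists s, 1 - s * r \in L.

(** Coefficients act on [rann L] only modulo [L], so independence says that the [v j] span a direct
    sum of [q] copies of the simple module [R/L]. *)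
Definition indep_mod q (v : {ffun 'I_q -> R}) :=
  [forall j, v j \in rann L] &&
  [forall e, (lspan v e == 0) ==> [forall j, e j \in L]].

Lemma indep_modP q (v : {ffun 'I_q -> R}) :
  reflect ((forall j, v j \in rann L) /\
           (forall e, lspan v e = 0 -> forall j, e j \in L))
          (indep_mod v).
Proof.
apply: (iffP andP) => [[/forallP Av /forallP iv]|[Av iv]]; split=> //.
- by move=> e /eqP ve; apply/forallP; apply: (implyP (iv e)).
- exact/forallP.
by apply/forallP=> e; apply/implyP=> /eqP/iv ?; apply/forallP.
Qed.

(** Two equal entries would give a relation with coefficient 1, outside [L]. The bound ensures that
    a family of maximal size exists. *)
Lemma indep_mod_size q (v : {ffun 'I_q -> R}) : indep_mod v -> (q <= #|R|)%N.
Proof.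
case/indep_modP=> _ iv; rewrite -[q]card_ord; apply: (@leq_card _ _ v).
move=> i j vij; apply/eqP; apply: contraNT properL => /negPf ij.
have := iv ([ffun k => (k == i)%:R] - [ffun k => (k == j)%:R]).
rewrite lspanB !lspan_delta vij subrr => /(_ erefl i).
by rewrite !ffunE eqxx ij subr0.
Qed.

Lemma rann_indep_basis :
  exists q (v : {ffun 'I_q -> R}), indep_mod v /\
    forall x, x \in rann L -> exists e, x = lspan v e.
Proof.
pose P q := [exists v : {ffun 'I_q -> R}, indep_mod v].
have P0 : exists q, P q.
  exists 0; apply/existsP; exists [ffun=> 0]; apply/indep_modP.
  by split=> [[]|e _ []].
have Pb q : P q -> (q <= #|R|)%N by case/existsP=> v /indep_mod_size.
case: (ex_maxnP P0 Pb) => q /existsP[v iv] maxq; exists q, v; split=> // x Ax.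
have [Av {}iv] := indep_modP _ iv.
suff /imsetP[e _ ->] : x \in [set lspan v e | e : {ffun 'I_q -> R}] by exists e.
apply: contraT => nx; suff /maxq : P q.+1 by rewrite ltnn.
pose v' := [ffun i : 'I_q.+1 => oapp v x (unlift ord0 i)].
have v'0 : v' ord0 = x by rewrite ffunE unlift_none.
have v'S j : v' (lift ord0 j) = v j by rewrite ffunE liftK.
apply/existsP; exists v'; apply/indep_modP; split=> [i|e].
  by case: (unliftP ord0 i) => [j ->|->]; rewrite ?v'0 ?v'S.
rewrite /lspan big_ord_recl v'0 (eq_bigr _ (fun j _ => congr1 _ (v'S j))) => ve.
pose e1 := [ffun j : 'I_q => e (lift ord0 j)].
have {}ve : e ord0 * x + lspan v e1 = 0.
  by rewrite -[RHS]ve; congr (_ + _); apply: eq_bigr => j _; rewrite ffunE.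
have Le0 : e ord0 \in L.
  (* If [e ord0] is outside [L], some [1 - s * e ord0] in [L] kills [x], and the relation expresses
     [x] through [v]. *)
  apply: contraT => /maxL[s Ls]; case/negP: nx; apply/imsetP.
  exists [ffun j => - s * e1 j] => //; rewrite lspanZ.
  have /eqP := rannP _ _ Ax _ Ls; rewrite mulrBl mul1r subr_eq0 => /eqP ->.
  move/eqP: ve; rewrite addr_eq0 => /eqP ve.
  by rewrite -mulrA ve mulrN mulNr.
have := ve; rewrite (rannP _ _ Ax _ Le0) add0r => /iv Le1 i.
by case: (unliftP ord0 i) => [j ->|->] //; have := Le1 j; rewrite ffunE.
Qed.

(* With [v] a maximal independent family in [rann L], the left ideal spanned by
   [v] is semisimple isotypic and generated by one element [lspan v t].  Every
   element of [rann L] is [lspan v e] with [L e_j] inside [L], and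
   [e |-> \sum_j t_j e_j] is injective modulo [L] because the homomorphism
   [lspan v r |-> \sum_j r_j e_j + L] is determined by its value on the
   generator. *)
Lemma card_rann_max : (#|rann L| * #|L| <= #|R|)%N.
Proof.
have [q [v [/indep_modP[Av iv] spanv]]] := rann_indep_basis.
have [s Ds] := pid (lspan_left_ideal v).
have [t Dt] : exists t, s = lspan v t.
  have /imsetP[t _ ->] : s \in [set lspan v e | e : {ffun 'I_q -> R}].
    by rewrite Ds; apply/imsetP; exists 1; rewrite ?mul1r.
  by exists t.
have gen i : exists rho, rho * s = v i.
  have : v i \in lprincipal s.
    by rewrite -Ds; apply/imsetP; exists [ffun j => (j == i)%:R]; rewrite ?lspan_delta.
  by case/imsetP=> rho _ ->; exists rho.
pose co x : {ffun 'I_q -> R} := odflt 0 [pick e | x == lspan v e].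
have coK x : x \in rann L -> lspan v (co x) = x.
  move/spanv=> [e De]; rewrite /co; case: pickP => [f /eqP //|/(_ e)].
  by rewrite De eqxx.
pose phi (z : R * R) := \sum_j t j * co z.1 j + z.2.
rewrite -cardsX -[#|R|]cardsT.
rewrite -(@card_in_imset _ _ phi) ?subset_leq_card ?subsetT //.
move=> [x l] [y m]; rewrite !in_setX /= => /andP[Ax Ll] /andP[Ay Lm].
rewrite /phi /= => Dphi; set d := co x - co y.
have Lsd : \sum_j t j * d j \in L.
  have -> : \sum_j t j * d j = m - l; last exact: left_ideal_sub.
  transitivity (\sum_j t j * co x j - \sum_j t j * co y j).
    by rewrite -sumrB; apply: eq_bigr => j _; rewrite !ffunE mulrBr.
  by rewrite -[X in X - _](addrK l) Dphi -[_ + m - l]addrA addrAC subrr add0r.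
have xy_d : lspan v d = x - y by rewrite lspanB !coK //.
(* Elements of [L] kill [x - y], which is [lspan v d]; independence then gives [L d_j] inside
   [L]. *)
have Ldj r j : r \in L -> r * d j \in L.
  move=> Lr; have := iv [ffun j => r * d j]; rewrite lspanZ xy_d mulrBr.
  by rewrite (rannP _ _ Ax) // (rannP _ _ Ay) // subrr => /(_ erefl j); rewrite ffunE.
have Ld i : d i \in L.
  have [rho Drho] := gen i; have [_ LD LM] := idealL.
  (* Both [rho t] and the [i]-th unit family span [v i], so they agree modulo [L]. Hence [d i] is
     congruent to [rho * \sum_j t j * d j], which is in [L]. *)
  have Lrt j : rho * t j - (j == i)%:R \in L.
    have := iv ([ffun j => rho * t j] - [ffun j => (j == i)%:R]).
    by rewrite lspanB lspanZ lspan_delta -Dt Drho subrr => /(_ erefl j); rewrite !ffunE.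
  have -> : d i = rho * (\sum_j t j * d j) - \sum_j (rho * t j - (j == i)%:R) * d j.
    rewrite mulr_sumr -sumrB (bigD1 i) //= eqxx mulrBl mul1r mulrA subKr.
    rewrite big1 ?addr0 // => j /negPf ->.
    by rewrite subr0 mulrA subrr.
  rewrite left_ideal_sub ?LM //.
  by apply: left_ideal_sum => // j; apply: Ldj.
have /subr0_eq Dxy : x - y = 0.
  by rewrite -xy_d /lspan big1 // => j _; rewrite (rannP _ _ (Av j)).
by move: Dphi; rewrite Dxy => /addrI ->.
Qed.

End MaximalIdeal.
End LeftIdeals.

(** * Orthogonals of submodules and independent rows *)

Section Duality.
Variable R : finUnitRingType.

(** The module [N + R g], written exactly as a successful round of [greedy] builds it. *)
Definition adjoin k (N : {set 'rV[R]_k}) (g : 'rV_k) : {set 'rV[R]_k} :=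
  [set r *: g + c | r in [set: R], c in N].

Lemma adjoinP k (N : {set 'rV[R]_k}) (g z : 'rV_k) :
  reflect (exists r, exists2 c, c \in N & z = r *: g + c)
          (z \in adjoin N g).
Proof.
apply: (iffP imset2P) => [[r c _ Nc ->]|[r [c Nc ->]]]; first by exists r, c.
by exists r c.
Qed.

Lemma left_submodule_opp k (N : {set 'rV[R]_k}) x :
  left_submodule N -> x \in N -> - x \in N.
Proof. by case=> _ _ NZ Nx; rewrite -scaleN1r NZ. Qed.

Lemma left_submodule_sub k (N : {set 'rV[R]_k}) x y :
  left_submodule N -> x \in N -> y \in N -> x - y \in N.
Proof. by move=> hN Nx Ny; have [_ ND _] := hN; rewrite ND ?left_submodule_opp. Qed.

Lemma adjoin_submodule k (N : {set 'rV[R]_k}) (g : 'rV_k) :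
  left_submodule N -> left_submodule (adjoin N g).
Proof.
case=> N0 ND NZ; split.
- by apply/adjoinP; exists 0, 0; rewrite // scale0r addr0.
- move=> _ _ /adjoinP[r [c Nc ->]] /adjoinP[s [d Nd ->]]; apply/adjoinP.
  by exists (r + s), (c + d); rewrite ?ND // scalerDl addrACA.
move=> s _ /adjoinP[r [c Nc ->]]; apply/adjoinP.
by exists (s * r), (s *: c); rewrite ?NZ // scalerDr scalerA.
Qed.

Lemma sub_adjoin k (N : {set 'rV[R]_k}) (g : 'rV_k) :
  N \subset adjoin N g.
Proof.
by apply/subsetP=> c Nc; apply/adjoinP; exists 0, c; rewrite // scale0r add0r.
Qed.

Lemma mem_adjoin k (N : {set 'rV[R]_k}) (g : 'rV_k) :
  left_submodule N -> g \in adjoin N g.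
Proof. by case=> N0 _ _; apply/adjoinP; exists 1, 0; rewrite // scale1r addr0. Qed.

(** Count along [(r, c) |-> r g + c] from [R * N]: the first projection embeds its kernel into the
    set of [r] with [r g] in [N]. *)
Lemma card_adjoin k (N : {set 'rV[R]_k}) (g : 'rV_k) : left_submodule N ->
  (#|R| * #|N| <= #|adjoin N g|
                  * #|[set r | r *: g \in N]|)%N.
Proof.
move=> hN; have [N0 ND NZ] := hN.
pose f (z : R * 'rV[R]_k) : 'rV[R]_k := z.1 *: g + z.2.
have fB : {morph f : x y / x - y}.
  by move=> [r c] [s d]; rewrite /f /= scalerBl opprD addrACA.
rewrite -[#|R|]cardsT -cardsX.
rewrite (@card_additive_fibers (R * 'rV[R]_k)%type 'rV[R]_k f _ fB) => [|x y].
  have -> : f @: setX [set: R] N = adjoin N g.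
    apply/setP=> z; apply/imsetP/adjoinP => [[[r c]]|[r [c Nc ->]]].
      by rewrite in_setX => /andP[_ Nc] ->; exists r, c.
    by exists (r, c); rewrite // in_setX inE.
  apply: leq_mul => //.
  rewrite -(@card_in_imset _ _ fst).
    apply/subset_leq_card/subsetP=> _ /imsetP[[r c] + ->].
    rewrite inE in_setX inE /= => /andP[Nc].
    rewrite /f addr_eq0 /= => /eqP Dr.
    by rewrite inE Dr left_submodule_opp.
  move=> [r c] [s d]; rewrite !inE /f /= => /andP[_ /eqP rc] /andP[_ /eqP sd] rs.
  by congr (_, _); rewrite // -(addKr (r *: g) c) rc rs -sd addKr.
by rewrite !in_setX !inE /= => Nx Ny; apply: left_submodule_sub.
Qed.

Lemma rows_submodule m k (A : 'M[R]_(m, k)) :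
  left_submodule [set c *m A | c : 'rV_m].
Proof.
split=> [|_ _ /imsetP[c _ ->] /imsetP[d _ ->]|r _ /imsetP[c _ ->]].
- by apply/imsetP; exists 0; rewrite ?mul0mx.
- by apply/imsetP; exists (c + d); rewrite ?mulmxDl.
by apply/imsetP; exists (r *: c); rewrite ?scalemxAl.
Qed.

Definition perp k (N : {set 'rV[R]_k}) : {set 'cV[R]_k} :=
  [set w | [forall x in N, x *m w == 0]].

Lemma perpP k (N : {set 'rV[R]_k}) w :
  reflect (forall x, x \in N -> x *m w = 0) (w \in perp N).
Proof.
rewrite inE; apply: (iffP forall_inP) => H l Ll; last by rewrite H.
by apply/eqP/H.
Qed.

Hypothesis pid : principal_left_ideal_ring R.

(** Choosing [g] outside [N] with [N + R g] smallest makes [L], the set of [r] with [r g] in [N], a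
    maximal left ideal. The map [w |-> g w] sends [perp N] into [rann L] with kernel inside
    [perp (N + R g)]; [card_rann_max] and [card_adjoin] give the inequality. *)
Lemma perp_step k (N : {set 'rV[R]_k}) : left_submodule N -> N != setT ->
  exists N', [/\ left_submodule N', N \proper N' &
                 (#|N| * #|perp N| <= #|N'| * #|perp N'|)%N].
Proof.
move=> hN; rewrite -subTset => /subsetPn[g0 _ Ng0].
pose adj := adjoin N.
case: (arg_minnP (P := [pred g | g \notin N]) (fun g => #|adj g|) Ng0) => /=.
move=> g Ng gmin; exists (adj g); have [N0 ND NZ] := hN.
split; first exact: adjoin_submodule.
  by apply/properP; split; [apply: sub_adjoin | exists g; rewrite ?mem_adjoin].
pose L := [set r | r *: g \in N].
have idealL : left_ideal L.
  split=> [|r s|r s]; rewrite !inE ?scale0r ?scalerDl -?scalerA //.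
  exact: ND.
  exact: NZ.
have properL : 1 \notin L by rewrite inE scale1r.
have maxL r : r \notin L -> exists s, 1 - s * r \in L.
  rewrite inE => Nrg; have adj_rg : adj (r *: g) = adj g.
    apply/eqP; rewrite eqEcard gmin // andbT; apply/subsetP=> z.
    case/adjoinP=> s [c Nc ->]; apply/adjoinP; exists (s * r), c => //.
    by rewrite scalerA.
  have : g \in adj (r *: g) by rewrite adj_rg mem_adjoin.
  case/adjoinP=> s [c Nc Dg]; exists s; rewrite inE scalerBl scale1r.
  by rewrite {1}Dg scalerA addrAC subrr add0r.
have le_perp : (#|perp N| <= #|rann L| * #|perp (adj g)|)%N.
  pose f (w : 'cV[R]_k) := (g *m w) 0 0.
  have fB : {morph f : x y / x - y} by move=> x y; rewrite /f mulmxBr !mxE.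
  rewrite (@card_additive_fibers 'cV[R]_k R f _ fB) => [|x y Nx Ny].
    apply: leq_mul; apply/subset_leq_card/subsetP=> z.
      case/imsetP=> w /perpP Nw ->; apply/rannP=> l; rewrite inE => Nl.
      by have /matrixP/(_ 0 0) := Nw _ Nl; rewrite -scalemxAl [LHS]mxE [RHS]mxE.
    rewrite inE => /andP[/perpP Nz /eqP gz0]; apply/perpP=> x.
    case/adjoinP=> r [c Nc ->]; rewrite mulmxDl (Nz _ Nc) addr0 -scalemxAl.
    by rewrite [g *m z]mx11_scalar -/(f z) gz0 raddf0 scaler0.
  by apply/perpP=> z Nz; rewrite mulmxBr (perpP _ _ Nx) ?(perpP _ _ Ny) ?subrr.
have L_gt0 : (0 < #|L|)%N by apply/card_gt0P; exists 0; have [] := idealL.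
rewrite -(leq_pmul2r L_gt0).
apply: leq_trans (_ : #|N| * (#|rann L| * #|perp (adj g)|) * #|L| <= _)%N.
  by rewrite leq_mul2r leq_mul2l le_perp !orbT.
rewrite [(_ * #|perp (adj g)|)%N]mulnC mulnA -mulnA.
apply: leq_trans (_ : #|N| * #|perp (adj g)| * #|R| <= _)%N.
  by rewrite leq_mul2l card_rann_max ?orbT.
by rewrite mulnAC [(_ * #|L|)%N]mulnAC leq_mul2r [(#|N| * _)%N]mulnC card_adjoin ?orbT.
Qed.

(** The product never decreases along the steps up to the whole space, whose orthogonal is zero. *)
Lemma card_perp k (N : {set 'rV[R]_k}) : left_submodule N ->
  (#|N| * #|perp N| <= #|R| ^ k)%N.
Proof.
move: {2}(#|[set: 'rV[R]_k]| - #|N|)%N.+1 (ltnSn (#|[set: 'rV[R]_k]| - #|N|)%N) => d.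
elim: d N => // d IH N le_d hN; have [->|NT] := eqVneq N setT.
  have : (#|perp [set: 'rV[R]_k]| <= #|[set (0%R : 'cV[R]_k)]|)%N.
    apply/subset_leq_card/subsetP=> w /perpP Tw; rewrite inE.
    by apply/eqP/row_matrixP=> i; rewrite rowE Tw ?inE // row0.
  rewrite cards1 cardsT card_mx mul1n => le1.
  by rewrite -[leqRHS]muln1 leq_mul2l le1 orbT.
have [N' [hN' ltN le_perp]] := perp_step hN NT.
apply: leq_trans le_perp (IH _ _ hN').
have := proper_card ltN; have := subset_leq_card (subsetT N').
move=> le1 lt1; apply: leq_trans (ltn_sub2l _ lt1) _; last by rewrite -ltnS.
by apply: leq_trans lt1 le1.
Qed.

(** The row span [N] has [|R|^m] elements and [w |-> A w] has kernel [perp N]. By [card_perp] the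
    kernel is small enough to force surjectivity, so each column of the identity has a preimage. *)
Lemma independent_rows_right_inverse m k (A : 'M[R]_(m, k)) :
  (forall c : 'rV_m, c *m A = 0 -> c = 0) -> exists W, A *m W = 1%:M.
Proof.
move=> indA; have injA : injective (fun c : 'rV_m => c *m A).
  by move=> c d /eqP; rewrite -subr_eq0 -mulmxBl => /eqP/indA/subr0_eq.
pose N := [set c *m A | c : 'rV[R]_m].
have hN : left_submodule N by apply: rows_submodule.
pose f (w : 'cV[R]_k) := A *m w.
have fB : {morph f : x y / x - y} by move=> x y; rewrite /f mulmxBr.
have kerf : perp N = [set w in setT | f w == 0].
  apply/setP=> w; rewrite [RHS]in_set in_setT /=; apply/perpP/eqP => [Nw|Aw _ /imsetP[c _ ->]].
    apply/row_matrixP=> i; rewrite row0 row_mul rowE; apply: Nw.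
    by apply/imsetP; exists (delta_mx 0 i).
  by rewrite -mulmxA -/(f w) Aw mulmx0.
have /eqP imf : f @: setT == setT.
  rewrite eqEcard subsetT cardsT card_mx muln1 /=.
  have ker_gt0 : (0 < #|perp N|)%N.
    by apply/card_gt0P; exists 0; apply/perpP=> x _; rewrite mulmx0.
  rewrite -(leq_pmul2r ker_gt0) {2}kerf.
  rewrite -(@card_additive_fibers 'cV[R]_k 'cV[R]_m f _ fB); last first.
    by move=> x y _ _; rewrite inE.
  have := card_perp hN; rewrite cardsT card_mx muln1.
  by rewrite /N card_imset // card_mx mul1n.
have /fin_all_exists[w Dw] (j : 'I_m) : exists w, A *m w = delta_mx j 0 :> 'cV_m.
  have : delta_mx j 0 \in f @: setT by rewrite imf inE.
  by case/imsetP=> w _ ->; exists w.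
exists (\matrix_(i, j) w j i 0); apply/matrixP=> i j.
have /matrixP/(_ i 0) := Dw j; rewrite !mxE eqxx andbT => <-.
by apply: eq_bigr => l _; rewrite mxE.
Qed.

(** Only the coefficient of the new row must vanish; when the rows of [A] are independent, the other
    coefficients follow. *)
Definition extendible m k (A : 'M[R]_(m, k)) :=
  exists d : 'rV_k, forall r (c : 'rV_m), r *: d + c *m A = 0 -> r = 0.

Lemma extendible_mulmx m k (A : 'M[R]_(m, k)) (T S : 'M[R]_k) :
  S *m T = 1%:M -> extendible (A *m T) -> extendible A.
Proof.
move=> ST1 [d dP]; exists (d *m S) => r c /(congr1 (mulmx^~ T)).
rewrite mul0mx mulmxDl -scalemxAl -!mulmxA ST1 mulmx1; apply: dP.
Qed.

Lemma mul_elim_lower k (x : 'M[R]_(k, 1)) :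
  block_mx 1%:M 0 x 1%:M *m block_mx 1%:M 0 (- x) 1%:M = 1%:M :> 'M_(1 + k).
Proof.
rewrite mulmx_block !mulmx1 !mul1mx !mulmx0 !mul0mx !addr0 add0r subrr.
by rewrite -scalar_mx_block.
Qed.

Lemma mul_elim_upper k (x : 'M[R]_(1, k)) :
  block_mx 1%:M x 0 1%:M *m block_mx 1%:M (- x) 0 1%:M = 1%:M :> 'M_(1 + k).
Proof.
rewrite mulmx_block !mulmx1 !mul1mx !mulmx0 !mul0mx !addr0 !add0r addNr.
by rewrite -scalar_mx_block.
Qed.

(* Right stable range 1 lets column operations turn the corner entry into a
   unit and then clear the first row. *)
Lemma right_inverse_extendible m k (A : 'M[R]_(m, k)) W :
  A *m W = 1%:M -> (m < k)%N -> extendible A.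
Proof.
elim: m k A W => [|m IH] [|k] // A W AW1 lt_mk.
  exists (delta_mx 0 0) => r c; rewrite [c]thinmx0 mul0mx addr0.
  by move/matrixP/(_ 0 0); rewrite !mxE !eqxx mulr1.
rewrite ltnS in lt_mk.
suff clear_row (u : R) a (b : 'cV_m) (D : 'M_(m, k)) (X : 'M_(1 + k, 1 + m)) :
    u \is a GRing.unit -> block_mx (u%:M : 'M_1) a b D *m X = 1%:M ->
  extendible (block_mx (u%:M : 'M_1) a b D).
  pose A' : 'M_(1 + m, 1 + k) := A; pose W' : 'M_(1 + k, 1 + m) := W.
  move: AW1; change (A' *m W' = 1%:M -> extendible A'); rewrite -[A']submxK -[W']submxK.
  move: (ulsubmx A') (ursubmx A') (dlsubmx A') (drsubmx A') => al a b D.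
  move: (ulsubmx W') (ursubmx W') (dlsubmx W') (drsubmx W') => w1 w2 w3 w4 AWI.
  (* The corner of [A W = 1] reads [al w1 + a w3 = 1]; stable range makes [al + (a w3) t] a unit,
     reached by the column operation with [x = w3 t]. *)
  have := AWI; rewrite mulmx_block scalar_mx_block => /eq_block_mx[/matrixP/(_ 0 0)].
  rewrite !mxE big_ord1 eqxx -[\sum_j _]mulr1 => /right_stable_range1[t].
  set u := _ + _ * t => ut _ _ _.
  pose x := w3 *m (t%:M : 'M_1).
  have AU : block_mx al a b D *m block_mx 1%:M 0 x 1%:M
          = block_mx (u%:M : 'M_1) a (b + D *m x) D.
    rewrite mulmx_block !mulmx1 !mulmx0 !add0r; congr block_mx.
    rewrite [LHS]mx11_scalar mulmxA mxE [(_ *m t%:M) 0 0]mxE big_ord1.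
    by rewrite [t%:M 0 0]mxE eqxx [(a *m w3) 0 0]mxE.
  apply: (@extendible_mulmx (1 + m) (1 + k) _
    (block_mx 1%:M 0 x 1%:M) (block_mx 1%:M 0 (- x) 1%:M)).
    by have := mul_elim_lower (- x); rewrite opprK.
  rewrite AU; pose X := block_mx 1%:M 0 (- x) 1%:M *m block_mx w1 w2 w3 w4.
  apply: (clear_row _ _ _ _ X) => //.
  by rewrite -AU -mulmxA [X in _ *m X]mulmxA mul_elim_lower mul1mx.
move=> uu AX1; pose x := u^-1 *: a; pose D' := D - b *m x.
have AU : block_mx (u%:M : 'M_1) a b D *m block_mx 1%:M (- x) 0 1%:M
        = block_mx (u%:M : 'M_1) 0 b D'.
  rewrite mulmx_block !mulmx1 !mulmx0 !addr0 !mulmxN; congr block_mx.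
    by rewrite /x mul_scalar_mx scalerA divrr // scale1r addNr.
  by rewrite addrC.
apply: (@extendible_mulmx (1 + m) (1 + k) _
  (block_mx 1%:M (- x) 0 1%:M) (block_mx 1%:M x 0 1%:M)).
  exact: mul_elim_upper.
pose Y := block_mx 1%:M x 0 1%:M *m X.
have {AX1} : block_mx (u%:M : 'M_1) 0 b D' *m Y = 1%:M.
  rewrite -AU -mulmxA [X in _ *m X]mulmxA.
  by have := mul_elim_upper (- x); rewrite opprK => ->; rewrite mul1mx.
rewrite AU -[Y]submxK; move: (ulsubmx Y) (ursubmx Y) (dlsubmx Y) (drsubmx Y) => y1 y2 y3 y4.
rewrite mulmx_block scalar_mx_block => /eq_block_mx[_ y20 _ DY].
(* The upper right block gives [u y2 = 0]; the lower right one then reduces to [D' y4 = 1], to which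
   induction applies. *)
have {}y20 : y2 = 0.
  move: y20; rewrite mul0mx addr0 mul_scalar_mx => /(congr1 ( *:%R u^-1)).
  by rewrite scalerA mulVr // scale1r scaler0.
rewrite y20 mulmx0 add0r in DY.
have [d dP] := IH _ _ _ DY lt_mk.
exists (row_mx 0 d) => r c; rewrite -[c]hsubmxK mul_row_block scale_row_mx add_row_mx.
move/(congr1 (fun z : 'rV_(1 + k) => rsubmx z)).
rewrite row_mxKr mulmx0 add0r [RHS](_ : _ = 0); first exact: dP.
by apply/matrixP=> i j; rewrite !mxE.
Qed.

End Duality.

(** * The greedy algorithm *)

Section Ring.
Variable R : finUnitRingType.

Lemma lprincipal_self (x : R) : x \in lprincipal x.
Proof. by apply/imsetP; exists 1; rewrite ?mul1r. Qed.

(* If [R x + R y = R z] with [x = al z] and [y = be z], then [al], [be] and the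
   annihilator of [z] generate [R], and stable range turns [al] into a unit. *)
Lemma principal_add_multiple (x y : R) : principal_left_ideal_ring R ->
  exists t, (x \in lprincipal (x + t * y)) && (y \in lprincipal (x + t * y)).
Proof.
move=> pid; pose I := [set z.1 * x + z.2 * y | z : R * R].
have hI : left_ideal I.
  split=> [|_ _ /imsetP[[p q] _ ->] /imsetP[[r s] _ ->]|r _ /imsetP[[p q] _ ->]].
  - by apply/imsetP; exists (0, 0); rewrite //= !mul0r addr0.
  - by apply/imsetP; exists (p + r, q + s); rewrite //= !mulrDl addrACA.
  by apply/imsetP; exists (r * p, r * q); rewrite //= mulrDr !mulrA.
have [z Dz] := pid I hI.
have /imsetP[al _ Dx] : x \in lprincipal z.
  by rewrite -Dz; apply/imsetP; exists (1, 0); rewrite //= mul1r mul0r addr0.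
have /imsetP[be _ Dy] : y \in lprincipal z.
  by rewrite -Dz; apply/imsetP; exists (0, 1); rewrite //= mul1r mul0r add0r.
have : z \in I by rewrite Dz lprincipal_self.
case/imsetP=> [[p q]] _ /= Dpq; pose nu := 1 - p * al - q * be.
have nuz : nu * z = 0.
  by rewrite /nu !mulrBl mul1r -!mulrA -Dx -Dy {1}Dpq -addrA -opprD subrr.
have [|t ut] := @left_stable_range1 R al (q * be + nu) p 1.
  by rewrite mul1r addrA [nu](_ : _ = 1 - (p * al + q * be)) ?subrKC // opprD addrA.
(* Since [nu z = 0], the summand [t nu] of [u] disappears in [u z], leaving [x + t q y]. *)
set u := al + _ in ut; exists (t * q).
have -> : x + t * q * y = u * z.
  by rewrite /u mulrDl -[t * _ * z]mulrA mulrDl nuz addr0 -!mulrA -Dx -Dy.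
by apply/andP; split; [rewrite {1}Dx | rewrite {1}Dy];
   apply/imsetP; [exists (al * u^-1) | exists (be * u^-1)];
   rewrite // !mulrA divrK.
Qed.

Lemma combE n k (b : 'I_k -> 'rV[R]_n) c : comb b c = c *m \matrix_j b j.
Proof. by rewrite mulmx_sum_row; apply: eq_bigr => j _; rewrite rowK. Qed.

(** * The lexicographic order on coordinate rows *)

Section LexicographicOrder.
Variables (n : nat) (lt : rel R).
Hypothesis lt_order : strict_total_order lt.

Definition row_lt (c d : 'rV[R]_n) :=
  [exists k : 'I_n, [&& c 0 k != d 0 k,
     [forall j : 'I_n, (k < j)%N ==> (c 0 j == d 0 j)] & lt (c 0 k) (d 0 k)]].

Lemma row_ltP (c d : 'rV[R]_n) :
  reflect (exists k : 'I_n, [/\ c 0 k != d 0 k,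
             forall j : 'I_n, (k < j)%N -> c 0 j = d 0 j & lt (c 0 k) (d 0 k)])
          (row_lt c d).
Proof.
apply: (iffP existsP) => -[k].
  by case/and3P=> ne /forall_inP eq ltk; exists k; split=> // j /eq/eqP.
case=> ne eq ltk; exists k; rewrite ne ltk andbT /=.
by apply/forall_inP=> j /eq ->.
Qed.

Definition row_le (c d : 'rV[R]_n) := (c == d) || row_lt c d.

Lemma row_le_refl : reflexive row_le.
Proof. by move=> c; rewrite /row_le eqxx. Qed.

Lemma row_lt_trans : transitive row_lt.
Proof.
have [_ lt_tr _] := lt_order; have [lt_irr _ _] := lt_order.
move=> d c e /row_ltP[k [nk ek ltk]] /row_ltP[l [nl el ltl]]; apply/row_ltP.
have lt_ne a b : lt a b -> a != b by apply: contraTneq => ->; apply: lt_irr.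
case: (ltngtP k l) => [kl|lk|/val_inj kl].
- exists l; rewrite ek //; split=> // j lj.
  by rewrite ek ?el // (ltn_trans kl).
- exists k; rewrite -el //; split=> // j kj.
  by rewrite ek // el // (ltn_trans lk).
rewrite -{l}kl in nl el ltl; exists k; split=> [|j kj|].
- by apply: lt_ne; apply: lt_tr ltk ltl.
- by rewrite ek ?el.
exact: lt_tr ltk ltl.
Qed.

Lemma row_le_trans : transitive row_le.
Proof.
move=> d c e /orP[/eqP ->|cd] // /orP[/eqP <-|de]; first by rewrite /row_le cd orbT.
by rewrite /row_le (row_lt_trans cd de) orbT.
Qed.

Lemma row_le_total : total row_le.
Proof.
have [_ _ lt_tot] := lt_order.
move=> c d; rewrite /row_le [d == c]eq_sym; case: (eqVneq c d) => //= cd.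
have [k0 nk0] : exists k, c 0 k != d 0 k.
  apply/existsP; apply: contraNT cd; rewrite negb_exists => /forallP eq.
  by apply/eqP/rowP=> j; apply/eqP; have := eq j; rewrite negbK.
case: (arg_maxnP (P := fun k => c 0 k != d 0 k) (@nat_of_ord n) nk0) => k nk kmax.
have eq (j : 'I_n) : (k < j)%N -> c 0 j = d 0 j.
  by move=> kj; apply/eqP; apply: contraTT kj => /kmax; rewrite -leqNgt.
case/orP: (lt_tot _ _ nk) => ltk; apply/orP; [left | right]; apply/row_ltP.
  by exists k; split.
by exists k; split=> // [|j /eq]; rewrite // eq_sym.
Qed.

End LexicographicOrder.

(** * Coordinates, levels and the minimal candidate *)

Section Coordinates.
Variables (n : nat) (B : 'I_n -> 'rV[R]_n).
Hypothesis basisB : ordered_basis B.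

Lemma basis_coordK x : comb B (Defs.coord B x) = x.
Proof.
rewrite /Defs.coord; case: pickP => [c /eqP //|/=].
by have [g _ gK] := basisB; move/(_ (g x)); rewrite gK eqxx.
Qed.

Lemma combK c : Defs.coord B (comb B c) = c.
Proof. exact: (bij_inj basisB (basis_coordK _)). Qed.

Lemma basis_coord_linear r x y :
  Defs.coord B (r *: x + y) = r *: Defs.coord B x + Defs.coord B y.
Proof.
by rewrite -{1}[x]basis_coordK -{1}[y]basis_coordK !combE scalemxAl -mulmxDl -combE combK.
Qed.

Lemma basis_coord0 : Defs.coord B 0 = 0.
Proof. by rewrite -[RHS]combK combE mul0mx. Qed.

Lemma basis_coordZ r x : Defs.coord B (r *: x) = r *: Defs.coord B x.
Proof. by rewrite -[r *: x]addr0 basis_coord_linear basis_coord0 addr0. Qed.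

Lemma basis_coord_inj : injective (Defs.coord B).
Proof. exact: can_inj basis_coordK. Qed.

Lemma inVP i x :
  reflect (forall j : 'I_n, (i <= j)%N -> Defs.coord B x 0 j = 0) (inV B i x).
Proof.
apply: (iffP existsP) => [[c /andP[/eqP <- /forall_inP c0]] j ij|x0].
  by rewrite combK; apply/eqP/c0.
exists (Defs.coord B x); rewrite basis_coordK eqxx; apply/forall_inP=> j /x0 ->.
by rewrite eqxx.
Qed.

Lemma level_setP (i : 'I_n) x :
  reflect ((forall j : 'I_n, (i < j)%N -> Defs.coord B x 0 j = 0) /\ Defs.coord B x 0 i != 0)
          (level_set B i.+1 x).
Proof.
apply: (iffP andP) => [[/inVP x0 /inVP nx]|[x0 nx]]; split=> //.
- apply/eqP=> xi; apply: nx => j; rewrite leq_eqVlt => /orP[/eqP/val_inj <- //|].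
  exact: x0.
- exact/inVP.
by apply/inVP=> /(_ i (leqnn i)) /eqP; apply/negP.
Qed.

Variable lt : rel R.

(** A vector has only one level, so inside a level just the coordinate clause of [lexlt]
    survives. *)
Lemma lexltE (i : 'I_n) x y : level_set B i.+1 x -> level_set B i.+1 y ->
  lexlt lt B x y = (x != y) && row_lt lt (Defs.coord B x) (Defs.coord B y).
Proof.
move=> lx ly; have [x0 nx] := level_setP _ _ lx; have [y0 ny] := level_setP _ _ ly.
apply/existsP/idP => [[j /andP[lj]]|/andP[xy ltxy]]; last first.
  by exists i; rewrite lx ly xy; apply/orP; right.
have [yj nyj] := level_setP _ _ lj; suff -> : j = i.
  case/orP => [/inVP/(_ i (leqnn i)) xi|/and3P[_ xy ltxy]]; last by rewrite xy.
  by rewrite xi eqxx in nx.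
apply: val_inj; case: (ltngtP j i) => // [/yj yi|/y0 yi].
  by rewrite yi eqxx in ny.
by rewrite yi eqxx in nyj.
Qed.

Hypothesis lt_order : strict_total_order lt.

(** One candidate suffices: [row_le] is total, so a minimal candidate exists, and injectivity of
    coordinates makes it strictly smallest. *)
Lemma greedy_pick_exists P Gamma C (i : 'I_n) d :
  level_set B i.+1 d -> admissible P Gamma C d ->
  exists a, [/\ greedy_pick lt B P Gamma C i.+1 = Some a, level_set B i.+1 a,
    admissible P Gamma C a &
    forall y, level_set B i.+1 y -> admissible P Gamma C y -> y != a ->
      row_lt lt (Defs.coord B a) (Defs.coord B y)].
Proof.
move=> ld ad; rewrite /greedy_pick; case: pickP => [a|no].
  case/and3P=> la aa /forall_inP amin; exists a; split=> // y ly ay ya.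
  have := amin y; rewrite ly ay => /(_ isT); rewrite (negPf ya) /= (lexltE la ly).
  by case/andP.
pose cand a := level_set B i.+1 a && admissible P Gamma C a.
have cand_d : cand d by rewrite /cand ld.
have [a /andP[la aa] amin] := extremumP (Defs.coord B) (@row_le_refl n lt)
  (row_le_trans lt_order) (row_le_total lt_order) cand_d.
have := no a; rewrite la aa /=; case/negP; apply/forall_inP=> y cy.
case/andP: (cy) => ly _; have [//|ya] := eqVneq y a.
rewrite (lexltE la ly) eq_sym ya /=.
have := amin y cy; rewrite /row_le (inj_eq basis_coord_inj) eq_sym (negPf ya).
by [].
Qed.

End Coordinates.

Section Greedy.
Variables (n : nat) (lt : rel R) (B : 'I_n -> 'rV[R]_n) (P : 'rV[R]_n -> bool).
Variable Gamma : {set R}.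
Hypothesis P0 : P 0 = false.
Hypothesis genG : generator_system Gamma.

(** If [r] is nonzero, [Gamma] contains some [g = s r]; scaling the relation by [s] gives
    [g a + s c = 0], whereas admissibility would make [P 0] true. *)
Lemma admissible_independent C a : left_submodule C -> admissible P Gamma C a ->
  forall r c, c \in C -> r *: a + c = 0 -> r = 0.
Proof.
move=> [_ _ CZ] /forall_inP adm r c Cc rac; apply/eqP; apply: contraT => r0.
have [||g [[Gg Dg] _]] := genG.2 (lprincipal r); first exact: lprincipal_left_ideal.
  by apply/eqP=> /setP/(_ r); rewrite lprincipal_self inE (negPf r0).
have := lprincipal_self g; rewrite -Dg => /imsetP[s _ Ds].
have /forall_inP/(_ (s *: c) (CZ _ _ Cc)) := adm _ Gg.
by rewrite Ds -scalerA -scalerDr rac scaler0 P0.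
Qed.

Local Notation greedy := (greedy lt B P Gamma).

Lemma greedy_basis i : exists m (A : 'M[R]_(m, n)),
  (forall c : 'rV_m, c *m A = 0 -> c = 0) /\ greedy i = [set c *m A | c : 'rV_m].
Proof.
elim: i => [|i [m [A [indA Ci]]]].
  exists 0, 0; split=> [c _|]; first exact: thinmx0.
  apply/setP=> x; rewrite inE; apply/eqP/imsetP=> [->|[c _ ->]].
    by exists 0; rewrite ?mulmx0.
  by rewrite mulmx0.
rewrite /=; case Da: (greedy_pick _ _ _ _ _ _) => [a|]; last by exists m, A.
have hC : left_submodule (greedy i) by rewrite Ci; apply: rows_submodule.
have aa : admissible P Gamma (greedy i) a.
  by move: Da; rewrite /greedy_pick; case: pickP => // b /and3P[_ ab _] [<-].
exists (1 + m)%N, (col_mx a A); split=> [c|].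
  rewrite -[c]hsubmxK mul_row_col [lsubmx c]mx11_scalar mul_scalar_mx => ca0.
  have Cc : rsubmx c *m A \in greedy i by rewrite Ci; apply/imsetP; exists (rsubmx c).
  have r0 := admissible_independent hC aa Cc ca0; rewrite r0 in ca0 *.
  by move: ca0; rewrite scale0r add0r => /indA->; rewrite raddf0 row_mx0.
apply/setP=> x; apply/adjoinP/imsetP => [[r [c Cc ->]]|[c _ ->]].
  move: Cc; rewrite Ci => /imsetP[e _ ->]; exists (row_mx r%:M e) => //.
  by rewrite mul_row_col mul_scalar_mx.
exists (lsubmx c 0 0), (rsubmx c *m A); first by rewrite Ci; apply/imsetP; exists (rsubmx c).
by rewrite -{1}[c]hsubmxK mul_row_col {1}[lsubmx c]mx11_scalar mul_scalar_mx.
Qed.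

Lemma greedy_submodule i : left_submodule (greedy i).
Proof. by have [m [A [_ ->]]] := greedy_basis i; apply: rows_submodule. Qed.

Lemma greedy_mono i j : (i <= j)%N -> greedy i \subset greedy j.
Proof.
elim: j => [|j IH]; first by rewrite leqn0 => /eqP ->.
rewrite leq_eqVlt ltnS => /orP[/eqP -> //|/IH sub]; apply: subset_trans sub _.
by rewrite /=; case: (greedy_pick _ _ _ _ _ _) => // a; apply: sub_adjoin.
Qed.

End Greedy.
End Ring.

(** Write [A = X M] with [M] a basis of [Ct]. Cardinalities give [m < k], and the rows of [X] are
    independent, so an extra row [d] exists for [X]; [d M] serves for [A]. *)
Lemma free_submodule_proper (R : finUnitRingType) n m (A : 'M[R]_(m, n))
    (Ct : {set 'rV[R]_n}) :
  principal_left_ideal_ring R -> (forall c : 'rV_m, c *m A = 0 -> c = 0) ->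
  free_left_submodule Ct -> [set c *m A | c : 'rV_m] \proper Ct ->
  exists2 d, d \in Ct & forall r (c : 'rV_m), r *: d + c *m A = 0 -> r = 0.
Proof.
move=> pid indA [_ [k [b [injb CtP]]]] ltC; pose M := \matrix_j b j.
have injM : injective (fun c : 'rV_k => c *m M) by move=> c d; rewrite -!combE => /injb.
have DCt : Ct = [set c *m M | c : 'rV_k].
  apply/setP=> x; apply/idP/imsetP => [/CtP[c <-]|[c _ ->]]; last first.
    by apply/CtP; exists c; rewrite combE.
  by exists c; rewrite ?combE.
have injA : injective (fun c : 'rV_m => c *m A).
  by move=> c d /eqP; rewrite -subr_eq0 -mulmxBl => /eqP/indA/subr0_eq.
have lt_mk : (m < k)%N.
  have := proper_card ltC; rewrite DCt !card_imset // !card_mx !mul1n.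
  by rewrite ltn_exp2l ?card_finNzRing_gt1.
have /fin_all_exists[w Dw] (i : 'I_m) : exists w, row i A = w *m M.
  have : row i A \in Ct.
    apply: (subsetP (proper_sub ltC)); rewrite rowE.
    by apply/imsetP; exists (delta_mx 0 i).
  by rewrite DCt => /imsetP[w _ ->]; exists w.
pose X := \matrix_i w i; have DA : A = X *m M.
  by apply/row_matrixP=> i; rewrite row_mul rowK.
have [|W XW1] := independent_rows_right_inverse pid (A := X).
  by move=> c cX0; apply: indA; rewrite DA mulmxA cX0 mul0mx.
have [d dP] := right_inverse_extendible XW1 lt_mk; exists (d *m M).
  by rewrite DCt; apply/imsetP; exists d.
move=> r c; rewrite DA mulmxA scalemxAl -mulmxDl -(mul0mx _ M) => /injM.
exact: dP.
Qed.

Theorem mainTheorem10 (R : finUnitRingType) (n : nat)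
  (lt : rel R) (B : 'I_n -> 'rV[R]_n) (P : 'rV[R]_n -> bool)
  (Gamma : {set R}) :
  principal_left_ideal_ring R ->
  strict_total_order lt -> respectful lt ->
  ordered_basis B ->
  left_multiplicative P -> P 0 = false ->
  generator_system Gamma ->
  ~ (exists Ct : {set 'rV[R]_n},
       [/\ free_left_submodule Ct,
           lexicode lt B P Gamma \proper Ct &
           forall x, x \in Ct -> x != 0 -> P x]).
Proof.
move=> pid lt_order respect basisB _ P0 genG [Ct [freeCt ltC PCt]].
have hCt : left_submodule Ct by case: freeCt.
have [Ct0 CtD CtZ] := hCt; set C := lexicode lt B P Gamma in ltC.
have hC : left_submodule C := greedy_submodule lt B P0 genG n.
have [C0 CD CZ] := hC; have sCCt := subsetP (proper_sub ltC).
pose free_over d := [forall r : R, forall c in C, (r *: d + c == 0) ==> (r == 0)].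
have freeP d : reflect (forall r c, c \in C -> r *: d + c = 0 -> r = 0) (free_over d).
  apply: (iffP forallP) => fd r.
    by move=> c Cc /eqP; have /forall_inP/(_ c Cc)/implyP := fd r; move=> H /H/eqP.
  by apply/forall_inP=> c Cc; apply/implyP=> /eqP/(fd _ _ Cc)/eqP.
pose Q i := [exists d in Ct, free_over d && inV B i d].
have Qn : Q n.
  have [m [A [indA DC]]] := greedy_basis lt B P0 genG n.
  rewrite /C /lexicode DC in ltC.
  have [d Ctd dP] := free_submodule_proper pid indA freeCt ltC.
  apply/exists_inP; exists d => //; apply/andP; split.
    by apply/freeP=> r c; rewrite /C /lexicode DC => /imsetP[e _ ->]; apply: dP.
  by apply/(inVP basisB)=> j; rewrite leqNgt ltn_ord.
have exQ : exists i, Q i by exists n.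
case: (ex_minnP exQ) => i /exists_inP[d Ctd /andP[/freeP fd Vd]] imin.
case: i => [|i] in Vd imin *.
  have d0 : d = 0.
    by apply: (basis_coord_inj basisB); apply/rowP=> j;
       rewrite basis_coord0 // (inVP _ _ _ Vd) ?mxE.
  have := fd 1 0 C0; rewrite d0 scaler0 addr0 => /(_ erefl)/eqP.
  by rewrite oner_eq0.
have lt_in : (i < n)%N by have := imin _ Qn.
pose o := Ordinal lt_in; have nV e : e \in Ct -> free_over e -> ~~ inV B i e.
  move=> Cte fe; apply/negP=> Ve; have : Q i by apply/exists_inP; exists e; rewrite ?fe.
  by move/imin; rewrite ltnn.
have ld : level_set B o.+1 d by rewrite /level_set Vd nV //; apply/freeP.
set Ci := greedy lt B P Gamma i.
have sCi : Ci \subset C by apply: greedy_mono; apply: ltnW.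
have hCi : left_submodule Ci by apply: greedy_submodule.
(* Each [g d + c] lies in [Ct], and it is nonzero because [g] is nonzero and [d] is free over
   [C]. *)
have ad : admissible P Gamma Ci d.
  apply/forall_inP=> g Gg; apply/forall_inP=> c /(subsetP sCi) Cc.
  apply: PCt; first exact: CtD (CtZ _ _ Ctd) (sCCt _ Cc).
  by apply: contraNneq (genG.1 _ Gg) => /(fd _ _ Cc)/eqP.
have [a [Da la aa amin]] := greedy_pick_exists basisB lt_order ld ad.
have Ca : a \in C.
  apply: (subsetP (greedy_mono lt B P Gamma lt_in)); rewrite /= -/Ci Da.
  exact: mem_adjoin.
have inda := admissible_independent P0 genG hCi aa.
set x := Defs.coord B a 0 o; set y := Defs.coord B d 0 o.
have [a0 nx] := level_setP basisB _ _ la; have [d0 ny] := level_setP basisB _ _ ld.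
(* If [y = r x], then [d - r a] is still free over [C] and has lost its leading coordinate, against
   the minimality of the level. *)
have nxy : y \notin lprincipal x.
  apply/negP=> /imsetP[r _ Dy]; have Ctda : d - r *: a \in Ct.
    by rewrite left_submodule_sub // CtZ // sCCt.
  have fda : free_over (d - r *: a).
    apply/freeP=> s c Cc; rewrite scalerBr scalerA -addrA => sdc.
    apply: (fd s (- ((s * r) *: a) + c)) => //.
    exact: CD _ _ (left_submodule_opp hC (CZ _ _ Ca)) Cc.
  case/negP: (nV _ Ctda fda); apply/(inVP basisB)=> j.
  rewrite leq_eqVlt addrC -scaleNr basis_coord_linear // !mxE.
  case/orP=> [/eqP ij|ij]; last by rewrite a0 // d0 // mulr0 addr0.
  have -> : j = o by apply: val_inj.
  by rewrite -/x -/y Dy mulNr addNr.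
have [t /andP[xz yz]] := principal_add_multiple x y pid.
set z := x + t * y in xz yz.
have nz : z != 0.
  apply: contraNneq nx => z0; move: xz; rewrite z0 => /imsetP[r _].
  by rewrite mulr0 -/x => /eqP.
have lt_xz : lprincipal x \proper lprincipal z.
  apply/properP; split; last by exists y.
  case/imsetP: xz => r _ Dx; apply/subsetP=> _ /imsetP[s _ ->].
  by apply/imsetP; exists (s * r); rewrite // -mulrA -Dx.
have [al ual ltal] := respect _ _ nz nx lt_xz.
have {}ltal : lt (al * z) x by have := ltal 1 (unitr1 _); rewrite mul1r.
pose a' := al *: (t *: d + a).
have a'E j : Defs.coord B a' 0 j = al * (t * Defs.coord B d 0 j + Defs.coord B a 0 j).
  by rewrite basis_coordZ // basis_coord_linear // !mxE.
have a'o : Defs.coord B a' 0 o = al * z by rewrite a'E -/x -/y addrC.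
have la' : level_set B o.+1 a'.
  apply/(level_setP basisB); split=> [j oj|].
    by rewrite a'E a0 // d0 // !(mulr0, addr0).
  rewrite a'o; apply: contraNneq nz => alz.
  by apply/eqP/(mulrI ual); rewrite alz mulr0.
have aa' : admissible P Gamma Ci a'.
  apply/forall_inP=> g Gg; apply/forall_inP=> c Cic.
  have Cc := subsetP sCi _ Cic.
  apply: PCt; first exact: CtD (CtZ _ _ (CtZ _ _ (CtD _ _ (CtZ _ _ Ctd) (sCCt _ Ca))))
                             (sCCt _ Cc).
  apply: contraNneq (genG.1 _ Gg); rewrite /a' scalerA scalerDr scalerA -addrA => gz.
  (* Were the vector zero, freeness of [d] over [C] would kill the coefficient of [d]; independence
     of [a] over [Ci] then kills [g al], so [g = 0]. *)
  have gt0 : g * al * t = 0 by apply: fd gz; rewrite CD ?CZ.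
  move: gz; rewrite gt0 scale0r add0r => /(inda _ _ Cic) gal0.
  by apply/eqP/(mulIr ual); rewrite gal0 mul0r.
have [lt_irr lt_tr _] := lt_order.
have neqa : a' != a.
  by apply: contraTneq ltal => aa'E; rewrite -a'o aa'E -/x.
have /row_ltP[k [nk eqk ltk]] := amin _ la' aa' neqa.
have [a'0 _] := level_setP basisB _ _ la'.
(* Above [o] both coordinates vanish; below [o] the leading ones would agree, contradicting
   [al z < x]. *)
have Dk : k = o.
  apply: val_inj; case: (ltngtP k o) => // ko.
    by move: ltal; rewrite -a'o -eqk // -/x (negPf (lt_irr x)).
  by rewrite a0 // a'0 // eqxx in nk.
move: ltk; rewrite Dk a'o -/x => /(lt_tr _ _ _ ltal).
by rewrite (negPf (lt_irr _)).
Qed.
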